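(* Let $\mathcal P$ be a set of formulas and let $\mathcal K$ be a stable set of formulas such that $\mathcal K\subseteq\mathcal P$ and $0\notin\mathcal K$. If $\Gamma,\Delta$ are finite multisets of formulas of $\mathcal K$, then $\Gamma\vdash_{\mathcal P}\Delta;$ (with empty stoup) if and only if $\Gamma\vdash_{\mathrm{LK}}\Delta$.
   Context: Formulas are given by the grammar $F ::= 0 \mid \perp \mid X \mid F\wedge F \mid F\vee F \mid F\rightarrow F$, where $X$ ranges over a set $\mathcal V$ of propositional variables and $0$, $\perp$ are two distinct constants. A set $\mathcal S$ of formulas is stable if for every $c\in\{\wedge,\vee,\rightarrow\}$, $A\,c\,B\in\mathcal S$ implies $A,B\in\mathcal S$. $\mathrm{LK}$ denotes Gentzen's classical propositional sequent calculus over formulas built from the variables $\mathcal V$ and the constant $\perp$ with $\wedge,\vee,\rightarrow$, where $\perp$ is the absurdity (with the axiom $\perp\vdash$); $\Gamma\vdash_{\mathrm{LK}}\Delta$ means the sequent is derivable in LK. Fix a set $\mathcal P$ of formulas. A $\mathcal P$-sequent is an expression $\Gamma\vdash\Delta;\Pi$ where $\Gamma,\Delta,\Pi$ are finite multisets of formulas, every formula of $\Delta$ (the body) belongs to $\mathcal P$, and $\Pi$ (the stoup) contains at most one formula. The system $\mathrm{ML}_{\mathcal P}$ derives $\mathcal P$-sequents with the following rules (below $C$ denotes a single formula, $\Pi$ a stoup with at most one formula, and all sequents must be $\mathcal P$-sequents): Axiom/cuts: $ax$: $A\vdash ;A$. $cut_1$: from $\Gamma\vdash\Delta;A$ and $\Gamma',A\vdash\Delta';\Pi$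 infer $\Gamma,\Gamma'\vdash\Delta,\Delta';\Pi$. $cut_2$: from $\Gamma\vdash\Delta,A;\Pi$ and $\Gamma',A\vdash\Delta';$ infer $\Gamma,\Gamma'\vdash\Delta,\Delta';\Pi$. Structure: $der$: from $\Gamma\vdash\Delta;A$ with $A\in\mathcal P$ infer $\Gamma\vdash\Delta,A;$. $c_l$: from $\Gamma,A,A\vdash\Delta;\Pi$ infer $\Gamma,A\vdash\Delta;\Pi$. $c_r$: from $\Gamma\vdash\Delta,A,A;\Pi$ infer $\Gamma\vdash\Delta,A;\Pi$. $w_l$: from $\Gamma\vdash\Delta;\Pi$ infer $\Gamma,A\vdash\Delta;\Pi$. $w_r$: from $\Gamma\vdash\Delta;\Pi$ with $A\in\mathcal P$ infer $\Gamma\vdash\Delta,A;\Pi$. Logic: $0$: $\Gamma,0\vdash\Delta;\Pi$ (any $\Delta\subseteq\mathcal P$). $\perp$: $\perp\vdash ;$. $\wedge^1_l$: from $\Gamma,A,B\vdash\Delta;C$ with $A\notin\mathcal P$ and $B\notin\mathcal P$ infer $\Gamma,A\wedge B\vdash\Delta;C$. $\wedge^2_l$: from $\Gamma,A,B\vdash\Delta;$ infer $\Gamma,A\wedge B\vdash\Delta;$. $\wedge^1_r$: from $\Gamma\vdash\Delta;A$ and $\Gamma'\vdash\Delta';B$ infer $\Gamma,\Gamma'\vdash\Delta,\Delta';A\wedge B$. $\wedge^2_r$: from $\Gamma\vdash\Delta,A;$ and $\Gamma'\vdash\Delta',B;$ infer the same conclusion. $\wedge^3_r$: from $\Gamma\vdash\Delta;A$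 and $\Gamma'\vdash\Delta',B;$ infer the same conclusion. $\wedge^4_r$: from $\Gamma\vdash\Delta,A;$ and $\Gamma'\vdash\Delta';B$ infer the same conclusion. $\vee^1_l$: from $\Gamma,A\vdash\Delta;C$ and $\Gamma,B\vdash\Delta;C$ with $A\notin\mathcal P$ and $B\notin\mathcal P$ infer $\Gamma,A\vee B\vdash\Delta;C$. $\vee^2_l$: from $\Gamma,A\vdash\Delta;$ and $\Gamma,B\vdash\Delta;$ infer $\Gamma,A\vee B\vdash\Delta;$. $\vee^1_r$: from $\Gamma\vdash\Delta;A$ infer $\Gamma\vdash\Delta;A\vee B$. $\vee^2_r$: from $\Gamma\vdash\Delta;B$ infer $\Gamma\vdash\Delta;A\vee B$. $\vee^3_r$: from $\Gamma\vdash\Delta,A;$ infer $\Gamma\vdash\Delta;A\vee B$. $\vee^4_r$: from $\Gamma\vdash\Delta,B;$ infer $\Gamma\vdash\Delta;A\vee B$. $\rightarrow^1_l$: from $\Gamma,B\vdash\Delta;C$ and $\Gamma'\vdash\Delta';A$ with $B\notin\mathcal P$ infer $\Gamma,\Gamma',A\rightarrow B\vdash\Delta,\Delta';C$. $\rightarrow^2_l$: from $\Gamma,B\vdash\Delta;$ and $\Gamma'\vdash\Delta';A$ infer $\Gamma,\Gamma',A\rightarrow B\vdash\Delta,\Delta';$. $\rightarrow^3_l$: from $\Gamma,B\vdash\Delta;$ and $\Gamma'\vdash\Delta',A;\Pi$ infer $\Gamma,\Gamma',A\rightarrow B\vdash\Delta,\Delta';\Pi$. $\rightarrow^1_r$: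 from $\Gamma,A\vdash\Delta;B$ infer $\Gamma\vdash\Delta;A\rightarrow B$. $\rightarrow^2_r$: from $\Gamma,A\vdash\Delta,B;$ infer $\Gamma\vdash\Delta;A\rightarrow B$. One writes $\Gamma\vdash_{\mathcal P}\Delta;\Pi$ when the $\mathcal P$-sequent $\Gamma\vdash\Delta;\Pi$ is derivable in $\mathrm{ML}_{\mathcal P}$. *)

(* Defs.v *)
From Stdlib Require Import List Permutation.
Import ListNotations.

Set Implicit Arguments.

Inductive formula (V : Type) : Type :=
| Zero : formula V
| Bot : formula V
| Var : V -> formula V
| And : formula V -> formula V -> formula V
| Or : formula V -> formula V -> formula V
| Imp : formula V -> formula V -> formula V.

Arguments Zero {V}.
Arguments Bot {V}.

Definition stable (V : Type) (S : formula V -> Prop) : Prop :=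
  (forall A B, S (And A B) -> S A /\ S B) /\
  (forall A B, S (Or A B) -> S A /\ S B) /\
  (forall A B, S (Imp A B) -> S A /\ S B).

(* Finite multisets are lists taken up to [Permutation]: the exchange rules
   below make derivability depend only on the underlying multisets.
   "Gamma, A" is written [A :: Gamma]; the stoup is an [option]. *)

(* A body formula is only ever created by [ml_der], [ml_wr] and [ml_zero]; the
   conditions there keep every derived sequent a P-sequent ([ML_body]). *)
Inductive ML (V : Type) (P : formula V -> Prop) :
  list (formula V) -> list (formula V) -> option (formula V) -> Prop :=
| ml_exch G G' D D' S :
    Permutation G G' -> Permutation D D' -> ML P G D S -> ML P G' D' S
| ml_ax A : ML P [A] [] (Some A)
| ml_cut1 G G' D D' A S :
    ML P G D (Some A) -> ML P (A :: G') D' S ->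
    ML P (G ++ G') (D ++ D') S
| ml_cut2 G G' D D' A S :
    ML P G (A :: D) S -> ML P (A :: G') D' None ->
    ML P (G ++ G') (D ++ D') S
| ml_der G D A :
    P A -> ML P G D (Some A) -> ML P G (A :: D) None
| ml_cl G D A S :
    ML P (A :: A :: G) D S -> ML P (A :: G) D S
| ml_cr G D A S :
    ML P G (A :: A :: D) S -> ML P G (A :: D) S
| ml_wl G D A S :
    ML P G D S -> ML P (A :: G) D S
| ml_wr G D A S :
    P A -> ML P G D S -> ML P G (A :: D) S
| ml_zero G D S :
    Forall P D -> ML P (Zero :: G) D S
| ml_bot : ML P [Bot] [] None
| ml_andl1 G D A B C :
    ~ P A -> ~ P B -> ML P (A :: B :: G) D (Some C) ->
    ML P (And A B :: G) D (Some C)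
| ml_andl2 G D A B :
    ML P (A :: B :: G) D None -> ML P (And A B :: G) D None
| ml_andr1 G G' D D' A B :
    ML P G D (Some A) -> ML P G' D' (Some B) ->
    ML P (G ++ G') (D ++ D') (Some (And A B))
| ml_andr2 G G' D D' A B :
    ML P G (A :: D) None -> ML P G' (B :: D') None ->
    ML P (G ++ G') (D ++ D') (Some (And A B))
| ml_andr3 G G' D D' A B :
    ML P G D (Some A) -> ML P G' (B :: D') None ->
    ML P (G ++ G') (D ++ D') (Some (And A B))
| ml_andr4 G G' D D' A B :
    ML P G (A :: D) None -> ML P G' D' (Some B) ->
    ML P (G ++ G') (D ++ D') (Some (And A B))
| ml_orl1 G D A B C :
    ~ P A -> ~ P B ->
    ML P (A :: G) D (Some C) -> ML P (B :: G) D (Some C) ->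
    ML P (Or A B :: G) D (Some C)
| ml_orl2 G D A B :
    ML P (A :: G) D None -> ML P (B :: G) D None ->
    ML P (Or A B :: G) D None
| ml_orr1 G D A B :
    ML P G D (Some A) -> ML P G D (Some (Or A B))
| ml_orr2 G D A B :
    ML P G D (Some B) -> ML P G D (Some (Or A B))
| ml_orr3 G D A B :
    ML P G (A :: D) None -> ML P G D (Some (Or A B))
| ml_orr4 G D A B :
    ML P G (B :: D) None -> ML P G D (Some (Or A B))
| ml_impl1 G G' D D' A B C :
    ~ P B -> ML P (B :: G) D (Some C) -> ML P G' D' (Some A) ->
    ML P (Imp A B :: G ++ G') (D ++ D') (Some C)
| ml_impl2 G G' D D' A B :
    ML P (B :: G) D None -> ML P G' D' (Some A) ->
    ML P (Imp A B :: G ++ G') (D ++ D') None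
| ml_impl3 G G' D D' A B S :
    ML P (B :: G) D None -> ML P G' (A :: D') S ->
    ML P (Imp A B :: G ++ G') (D ++ D') S
| ml_impr1 G D A B :
    ML P (A :: G) D (Some B) -> ML P G D (Some (Imp A B))
| ml_impr2 G D A B :
    ML P (A :: G) (B :: D) None -> ML P G D (Some (Imp A B)).

Lemma ML_body (V : Type) (P : formula V -> Prop) G D S :
  ML P G D S -> Forall P D.
Proof.
  induction 1; repeat match goal with
  | H : Forall _ (_ :: _) |- _ => inversion H; clear H; subst
  end; try apply Forall_app; auto.
  eapply Permutation_Forall; eassumption.
Qed.

Fixpoint zero_free (V : Type) (A : formula V) : Prop :=
  match A with
  | Zero => False
  | Bot | Var _ => True
  | And A B | Or A B | Imp A B => zero_free A /\ zero_free B
  end.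

(* The formulas of LK are the [zero_free] ones: every rule that brings in a new
   formula asks for it, so no other formula occurs in a derivation
   ([LK_zero_free]). *)
Inductive LK (V : Type) : list (formula V) -> list (formula V) -> Prop :=
| lk_exch G G' D D' :
    Permutation G G' -> Permutation D D' -> LK G D -> LK G' D'
| lk_ax A : zero_free A -> LK [A] [A]
| lk_cut G G' D D' A :
    LK G (A :: D) -> LK (A :: G') D' -> LK (G ++ G') (D ++ D')
| lk_cl G D A : LK (A :: A :: G) D -> LK (A :: G) D
| lk_cr G D A : LK G (A :: A :: D) -> LK G (A :: D)
| lk_wl G D A : zero_free A -> LK G D -> LK (A :: G) D
| lk_wr G D A : zero_free A -> LK G D -> LK G (A :: D)
| lk_bot : LK [Bot] []
| lk_andl1 G D A B : zero_free B -> LK (A :: G) D -> LK (And A B :: G) D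
| lk_andl2 G D A B : zero_free A -> LK (B :: G) D -> LK (And A B :: G) D
| lk_andr G D A B :
    LK G (A :: D) -> LK G (B :: D) -> LK G (And A B :: D)
| lk_orl G D A B :
    LK (A :: G) D -> LK (B :: G) D -> LK (Or A B :: G) D
| lk_orr1 G D A B : zero_free B -> LK G (A :: D) -> LK G (Or A B :: D)
| lk_orr2 G D A B : zero_free A -> LK G (B :: D) -> LK G (Or A B :: D)
| lk_impl G G' D D' A B :
    LK G (A :: D) -> LK (B :: G') D' -> LK (Imp A B :: G ++ G') (D ++ D')
| lk_impr G D A B : LK (A :: G) (B :: D) -> LK G (Imp A B :: D).

Lemma LK_zero_free (V : Type) (G D : list (formula V)) :
  LK G D -> Forall (@zero_free V) G /\ Forall (@zero_free V) D.
Proof.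
  induction 1; repeat match goal with
  | H : _ /\ _ |- _ => destruct H
  | H : Forall _ (_ :: _) |- _ => inversion H; clear H; subst
  end; split; repeat (apply Forall_cons || (apply Forall_app; split));
  simpl; auto; eapply Permutation_Forall; eassumption.
Qed.

(* Main.v *)
(** Both systems are sound for two-valued semantics in which [Zero] and [Bot]
    are false, and both simulate the invertible cut-free calculus [G3] on
    sequents of formulas of [K].  As [G3] is complete, each of the two
    derivability relations coincides there with validity; going through
    validity removes the cuts on formulas outside [K]. *)

Require Import Defs.
From Stdlib Require Import List.
From Stdlib Require Import Permutation Classical Lia.
Import ListNotations.

Set Implicit Arguments.

(** * Two-valued semantics and soundness *)

Fixpoint sat (V : Type) (v : V -> Prop) (A : formula V) : Prop :=
  match A with
  | Zero | Bot => False
  | Var x => v x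
  | And A B => sat v A /\ sat v B
  | Or A B => sat v A \/ sat v B
  | Imp A B => sat v A -> sat v B
  end.

Definition valid (V : Type) (G D : list (formula V)) : Prop :=
  forall v, Forall (sat v) G -> Exists (sat v) D.

(** By Glivenko's theorem a classical propositional consequence holds intuitionistically under a
    double negation, so [tauto] is enough after [NNPP]. *)
Ltac sat_tauto :=
  repeat progress rewrite ?Forall_cons_iff, ?Exists_cons, ?Exists_nil,
    ?Forall_app, ?Exists_app in *;
  simpl in *; apply NNPP; tauto.

Lemma LK_sound (V : Type) (G D : list (formula V)) : LK G D -> valid G D.
Proof.
  intros H v; induction H; try solve [sat_tauto].
  intros HG; eapply Permutation_Exists; [eassumption|].
  apply IHLK; eapply Permutation_Forall; [symmetry|]; eassumption.
Qed.

(** With the stoup read as one more disjunct on the right, each rule becomes a classically sound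
    one. *)
Lemma ML_sound (V : Type) (P : formula V -> Prop) G D S :
  ML P G D S -> forall v, Forall (sat v) G ->
  Exists (sat v) D \/ match S with Some A => sat v A | None => False end.
Proof.
  intros H v; induction H; try solve [sat_tauto].
  intros HG; destruct IHML as [HD|HS]; [|left|right; exact HS].
  - eapply Permutation_Forall; [symmetry|]; eassumption.
  - eapply Permutation_Exists; eassumption.
Qed.

(** * The calculus [G3] and its completeness *)

Inductive G3 (V : Type) : list (formula V) -> list (formula V) -> Prop :=
| g3_exch G G' D D' :
    Permutation G G' -> Permutation D D' -> G3 G D -> G3 G' D'
| g3_ax G D A : G3 (A :: G) (A :: D)
| g3_zero G D : G3 (Zero :: G) D
| g3_bot G D : G3 (Bot :: G) D
| g3_andl G D A B : G3 (A :: B :: G) D -> G3 (And A B :: G) D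
| g3_andr G D A B : G3 G (A :: D) -> G3 G (B :: D) -> G3 G (And A B :: D)
| g3_orl G D A B : G3 (A :: G) D -> G3 (B :: G) D -> G3 (Or A B :: G) D
| g3_orr G D A B : G3 G (A :: B :: D) -> G3 G (Or A B :: D)
| g3_impl G D A B : G3 G (A :: D) -> G3 (B :: G) D -> G3 (Imp A B :: G) D
| g3_impr G D A B : G3 (A :: G) (B :: D) -> G3 G (Imp A B :: D).

Fixpoint connectives (V : Type) (A : formula V) : nat :=
  match A with
  | Zero | Bot | Var _ => 0
  | And A B | Or A B | Imp A B => 1 + connectives A + connectives B
  end.

Definition weight (V : Type) (G : list (formula V)) : nat :=
  list_sum (map (@connectives V) G).

Lemma weight_perm (V : Type) (G G' : list (formula V)) :
  Permutation G G' -> weight G = weight G'.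
Proof. unfold weight; induction 1; simpl in *; lia. Qed.

Lemma valid_perm (V : Type) (G G' D D' : list (formula V)) :
  Permutation G G' -> Permutation D D' -> valid G D -> valid G' D'.
Proof.
  intros HG HD H v HG'; eapply Permutation_Exists; [exact HD|].
  apply H; eapply Permutation_Forall; [symmetry|]; eassumption.
Qed.

Lemma in_permutation_cons (T : Type) (x : T) (l : list T) :
  In x l -> exists l', Permutation (x :: l') l.
Proof.
  intros Hx; destruct (in_split _ _ Hx) as [l1 [l2 ->]].
  exists (l1 ++ l2); apply Permutation_middle.
Qed.

Lemma compound_or_atomic (V : Type) (G : list (formula V)) :
  (exists A G', Permutation (A :: G') G /\ connectives A <> 0) \/
  (forall A, In A G -> connectives A = 0).
Proof.
  destruct (classic (exists A, In A G /\ connectives A <> 0))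
    as [[A [HA HA0]]|H].
  - left; destruct (in_permutation_cons _ _ HA) as [G' HG']; eauto.
  - right; intros A HA; apply NNPP; intros HA0; apply H; eauto.
Qed.

Lemma G3_complete_atomic (V : Type) (G D : list (formula V)) :
  (forall A, In A G -> connectives A = 0) ->
  (forall A, In A D -> connectives A = 0) ->
  valid G D -> G3 G D.
Proof.
  intros HG HD H.
  destruct (classic (In Zero G)) as [H0|H0].
  { destruct (in_permutation_cons _ _ H0) as [G' HG'].
    exact (g3_exch HG' (Permutation_refl _) (g3_zero _ _)). }
  destruct (classic (In Bot G)) as [Hb|Hb].
  { destruct (in_permutation_cons _ _ Hb) as [G' HG'].
    exact (g3_exch HG' (Permutation_refl _) (g3_bot _ _)). }
  (* The valuation making true exactly the variables listed in [G] satisfies [G], since [G] contains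
     neither constant. Validity then gives a formula of [D] true under it, which must be a variable
     occurring on both sides. *)
  assert (HS : Exists (sat (fun x => In (Var x) G)) D).
  { apply H, Forall_forall; intros A HA; specialize (HG A HA).
    destruct A; simpl in *; try discriminate; tauto. }
  apply Exists_exists in HS; destruct HS as [A [HA HAG]].
  specialize (HD A HA).
  destruct A as [| |x| | |]; simpl in *; try discriminate; try tauto.
  destruct (in_permutation_cons _ _ HAG) as [G' HG'].
  destruct (in_permutation_cons _ _ HA) as [D' HD'].
  exact (g3_exch HG' HD' (g3_ax _ _ _)).
Qed.

(** Backward proof search: the logical rules are invertible for validity and their premises have
    fewer connectives, so the search ends in valid sequents of atoms. *)
Lemma G3_complete (V : Type) (G D : list (formula V)) : valid G D -> G3 G D.
Proof.
  remember (weight G + weight D) as n eqn:Hn; revert G D Hn.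
  induction n as [n IH] using (well_founded_induction Wf_nat.lt_wf).
  intros G D -> H.
  assert (IH' : forall G' D',
    weight G' + weight D' < weight G + weight D -> valid G' D' -> G3 G' D')
    by eauto.
  clear IH.
  destruct (compound_or_atomic G) as [[A [G' [HG HA]]]|HG].
  - apply (g3_exch HG (Permutation_refl _)).
    apply (valid_perm (Permutation_sym HG) (Permutation_refl _)) in H.
    rewrite <- (weight_perm HG) in IH'.
    (* [constructor] passes over [g3_exch], whose premise the goal does not determine, and selects
       the left rule of the connective. *)
    destruct A as [| |x|A B|A B|A B]; simpl in HA; try tauto;
      constructor; apply IH'; try (unfold weight; simpl; lia);
      intros v; specialize (H v); sat_tauto.
  - destruct (compound_or_atomic D) as [[A [D' [HD HA]]]|HD].
    + apply (g3_exch (Permutation_refl _) HD).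
      apply (valid_perm (Permutation_refl _) (Permutation_sym HD)) in H.
      rewrite <- (weight_perm HD) in IH'.
      destruct A as [| |x|A B|A B|A B]; simpl in HA; try tauto;
        constructor; apply IH'; try (unfold weight; simpl; lia);
        intros v; specialize (H v); sat_tauto.
    + apply G3_complete_atomic; assumption.
Qed.

(** * Contraction of whole contexts *)

(** [Q] stands for derivability as a property of one side of a sequent. The induction keeps [M]
    general because [M] takes up the formulas already contracted. *)
Lemma contract_app (T : Type) (Q : list T -> Prop) :
  (forall L M, Permutation L M -> Q L -> Q M) ->
  (forall x L, Q (x :: x :: L) -> Q (x :: L)) ->
  forall L M, Q (L ++ L ++ M) -> Q (L ++ M).
Proof.
  intros Hperm Hcontr; induction L as [|x L IH]; intros M H; [exact H|].
  apply (Hperm (L ++ x :: M)); [symmetry; apply Permutation_middle|].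
  apply IH, (Hperm (x :: (L ++ L) ++ M)).
  { rewrite (app_assoc L L); apply Permutation_middle. }
  apply Hcontr; refine (Hperm _ _ _ H); simpl.
  rewrite <- app_assoc; apply perm_skip; symmetry; apply Permutation_middle.
Qed.

Lemma contract_double (T : Type) (Q : list T -> Prop) :
  (forall L M, Permutation L M -> Q L -> Q M) ->
  (forall x L, Q (x :: x :: L) -> Q (x :: L)) ->
  forall L, Q (L ++ L) -> Q L.
Proof.
  intros Hperm Hcontr L H; rewrite <- (app_nil_r L).
  apply contract_app; try assumption; rewrite app_nil_r; exact H.
Qed.

Lemma contract_cons_double (T : Type) (Q : list T -> Prop) :
  (forall L M, Permutation L M -> Q L -> Q M) ->
  (forall x L, Q (x :: x :: L) -> Q (x :: L)) ->
  forall x L, Q (x :: L ++ L) -> Q (x :: L).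
Proof.
  intros Hperm Hcontr x L H.
  apply (Hperm (L ++ [x])); [symmetry; apply Permutation_cons_append|].
  apply contract_app; try assumption.
  refine (Hperm _ _ _ H); rewrite app_assoc; apply Permutation_cons_append.
Qed.

(** * Simulation of [G3] by a relation [R] on sequents over [K] *)

Section Simulation.

Variables (V : Type) (K : formula V -> Prop).
Hypotheses (K_stable : stable K) (K_zero : ~ K Zero).

Variable R : list (formula V) -> list (formula V) -> Prop.
Hypotheses
  (R_exch : forall G G' D D',
    Permutation G G' -> Permutation D D' -> R G D -> R G' D')
  (R_wl : forall A G D, K A -> R G D -> R (A :: G) D)
  (R_wr : forall A G D, K A -> R G D -> R G (A :: D))
  (R_ax : forall A, K A -> R [A] [A])
  (R_bot : R [Bot] [])
  (R_andl : forall G D A B,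
    K (And A B) -> R (A :: B :: G) D -> R (And A B :: G) D)
  (R_andr : forall G D A B,
    K (And A B) -> R G (A :: D) -> R G (B :: D) -> R G (And A B :: D))
  (R_orl : forall G D A B,
    K (Or A B) -> R (A :: G) D -> R (B :: G) D -> R (Or A B :: G) D)
  (R_orr : forall G D A B,
    K (Or A B) -> R G (A :: B :: D) -> R G (Or A B :: D))
  (R_impl : forall G D A B,
    K (Imp A B) -> R G (A :: D) -> R (B :: G) D -> R (Imp A B :: G) D)
  (R_impr : forall G D A B,
    K (Imp A B) -> R (A :: G) (B :: D) -> R G (Imp A B :: D)).

Lemma weaken_app (G G' D D' : list (formula V)) :
  Forall K G' -> Forall K D' -> R G D -> R (G' ++ G) (D' ++ D).
Proof.
  intros HG HD H; induction HG; simpl; [|auto].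
  induction HD; simpl; auto.
Qed.

(** Without cuts, stability of [K] keeps the premises of every logical rule inside [K], and
    [g3_zero] cannot occur there because it would put [Zero] in [K]. *)
Lemma G3_simulation (G D : list (formula V)) :
  G3 G D -> Forall K G -> Forall K D -> R G D.
Proof.
  destruct K_stable as [KA [KO KI]].
  induction 1 as [G G' D D' HG' HD' _ IH|G D A|G D|G D|G D A B _ IH
    |G D A B _ IH1 _ IH2|G D A B _ IH1 _ IH2|G D A B _ IH
    |G D A B _ IH1 _ IH2|G D A B _ IH]; intros HG HD.
  { apply (R_exch HG' HD'), IH;
      eapply Permutation_Forall; try (symmetry; eassumption); assumption. }
  all: try (apply Forall_cons_iff in HG as [HA HG]).
  all: try (apply Forall_cons_iff in HD as [HB HD]).
  - refine (R_exch _ _ (weaken_app HG HD (R_ax HA)));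
      symmetry; apply Permutation_cons_append.
  - contradiction.
  - refine (R_exch _ _ (weaken_app HG HD R_bot)).
    + symmetry; apply Permutation_cons_append.
    + rewrite app_nil_r; reflexivity.
  - destruct (KA _ _ HA); auto.
  - destruct (KA _ _ HB); auto.
  - destruct (KO _ _ HA); auto.
  - destruct (KO _ _ HB); auto.
  - destruct (KI _ _ HA); auto.
  - destruct (KI _ _ HB); auto.
Qed.

End Simulation.

(** * Completeness of LK on [zero_free] formulas *)

Lemma zero_free_stable (V : Type) : stable (@zero_free V).
Proof. repeat split; simpl in *; tauto. Qed.

(** Stability descends to all subformulas, so a [Zero] anywhere inside [A] would itself lie in
    [K]. *)
Lemma stable_zero_free (V : Type) (K : formula V -> Prop) :
  stable K -> ~ K Zero -> forall A, K A -> zero_free A.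
Proof.
  intros [KA [KO KI]] K0 A.
  induction A as [| |x|A IHA B IHB|A IHA B IHB|A IHA B IHB]; simpl; intros H.
  - contradiction.
  - exact I.
  - exact I.
  - destruct (KA _ _ H); auto.
  - destruct (KO _ _ H); auto.
  - destruct (KI _ _ H); auto.
Qed.

Lemma LK_complete (V : Type) (G D : list (formula V)) :
  Forall (@zero_free V) G -> Forall (@zero_free V) D -> valid G D -> LK G D.
Proof.
  intros HG HD H; apply G3_complete in H; revert H HG HD.
  apply G3_simulation; try (intros; constructor; assumption).
  - apply zero_free_stable.
  - simpl; tauto.
  - intros; eapply lk_exch; eassumption.
  (* The LK rule brings in one component at a time: the conjunction is formed once from each, and
     the two copies are contracted. Disjunction on the right is dual. *)
  - intros G' D' A B [HA HB] H; apply lk_cl, lk_andl1; [assumption|].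
    eapply lk_exch; [apply perm_swap|reflexivity|].
    apply lk_andl2; [assumption|].
    eapply lk_exch; [apply perm_swap|reflexivity|exact H].
  - intros G' D' A B [HA HB] H; apply lk_cr, lk_orr1; [assumption|].
    eapply lk_exch; [reflexivity|apply perm_swap|].
    apply lk_orr2; [assumption|].
    eapply lk_exch; [reflexivity|apply perm_swap|exact H].
  - intros G' D' A B _ H1 H2.
    assert (H := lk_impl H1 H2).
    (* [lk_impl] concatenates the contexts of its premises, so the shared contexts of [G3] come out
       doubled on both sides. *)
    apply (contract_double (fun L => LK _ L)) in H.
    + apply (contract_cons_double (fun L => LK L D')); [| |exact H].
      * intros; eapply lk_exch; [eassumption|reflexivity|assumption].
      * intros; apply lk_cl; assumption.
    + intros; eapply lk_exch; [reflexivity|eassumption|assumption].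
    + intros; apply lk_cr; assumption.
Qed.

(** * Completeness of [ML] on sequents over [K] *)

Lemma ML_exch_l (V : Type) (P : formula V -> Prop) D S G G' :
  Permutation G G' -> ML P G D S -> ML P G' D S.
Proof. intros HG; apply ml_exch; [exact HG|reflexivity]. Qed.

Lemma ML_exch_r (V : Type) (P : formula V -> Prop) G S D D' :
  Permutation D D' -> ML P G D S -> ML P G D' S.
Proof. intros HD; apply ml_exch; [reflexivity|exact HD]. Qed.

(** With the stoup empty, the left rules used carry no condition on [P]. A right rule builds its
    formula in the stoup, and [ml_der] moves it to the body because [K] is included in [P]. *)
Lemma ML_complete (V : Type) (P K : formula V -> Prop) :
  stable K -> (forall A, K A -> P A) -> ~ K Zero ->
  forall G D, Forall K G -> Forall K D -> valid G D -> ML P G D None.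
Proof.
  intros HK KP K0 G D HG HD H; apply G3_complete in H; revert H HG HD.
  apply (G3_simulation HK K0 (fun G D => ML P G D None)).
  - intros; eapply ml_exch; eassumption.
  - intros; apply ml_wl; assumption.
  - intros; apply ml_wr; auto.
  - intros; apply ml_der; [auto|apply ml_ax].
  - apply ml_bot.
  - intros; apply ml_andl2; assumption.
  - intros G' D' A B HA H1 H2.
    assert (H := ml_der (KP _ HA) (ml_andr2 H1 H2)).
    apply (contract_double (fun L => ML P L _ None)) in H;
      [|intros; eapply ML_exch_l; eassumption|intros; apply ml_cl; assumption].
    apply (contract_cons_double (fun L => ML P G' L None));
      [intros; eapply ML_exch_r; eassumption
      |intros; apply ml_cr; assumption|exact H].
  - intros; apply ml_orl2; assumption.
  - intros G' D' A B HA H.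
    (* Read from the premise on: the disjunction is formed from [A] and stored in the body, formed
       again from [B] and stored, and the two copies are contracted. *)
    apply ml_cr, ml_der; [auto|]; apply ml_orr4.
    eapply ML_exch_r; [apply perm_swap|].
    apply ml_der; [auto|]; apply ml_orr3; exact H.
  - intros G' D' A B HA H1 H2.
    (* [ml_impl3] is the left rule that takes [A] from the body, where [H1] has it. *)
    assert (H := ml_impl3 H2 H1).
    apply (contract_double (fun L => ML P _ L None)) in H;
      [|intros; eapply ML_exch_r; eassumption|intros; apply ml_cr; assumption].
    apply (contract_cons_double (fun L => ML P L D' None));
      [intros; eapply ML_exch_l; eassumption
      |intros; apply ml_cl; assumption|exact H].
  - intros; apply ml_der; [auto|]; apply ml_impr2; assumption.
Qed.

Theorem theorem4p2 :
  forall (V : Type) (P K : formula V -> Prop),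
    stable K ->
    (forall A : formula V, K A -> P A) ->
    ~ K Zero ->
    forall Gamma Delta : list (formula V),
      Forall K Gamma -> Forall K Delta ->
      (ML P Gamma Delta None <-> LK Gamma Delta).
Proof.
  intros V P K HK KP K0 G D HG HD; split; intros H.
  - apply LK_complete.
    + exact (Forall_impl _ (@stable_zero_free V K HK K0) HG).
    + exact (Forall_impl _ (@stable_zero_free V K HK K0) HD).
    + intros v Hv; destruct (ML_sound H v Hv); tauto.
  - apply (ML_complete P HK KP K0 HG HD), LK_sound, H.
Qed.
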